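(* Let $q>2$ be a prime power and $F=\mathbb{F}_{q^3}$. Let $\alpha=-1$ if $q$ is odd and let $\alpha$ be an element of $\mathbb{F}_q\setminus\{0,1\}$ if $q$ is even. For $a_0,a_1\in F$ let $M(a_0,a_1)=\begin{pmatrix}a_0&a_1&a_1^{q^2}\\ a_1&a_0^q&a_1^q\\ a_1^{q^2}&a_1^q&a_0^{q^2}\end{pmatrix}$, let $W=\{M(a_0,a_1):a_0,a_1\in F\}$ (a $6$-dimensional $\mathbb{F}_q$-vector space) and $\mathrm{PG}(W)\cong\mathrm{PG}(5,q)$ its projective space. For $\omega\in F^*$ let $\mathcal{V}_\omega$ be the set of points spanned by $M(x^2,\omega x^{q+1})$, $x\in F^*$, and let $\mathcal{S}_\omega$ be the image of $\mathcal{S}_1=\{\langle M(a_0,a_1)\rangle:\det M(a_0,a_1)=0\}$ under the projectivity induced by $M(a_0,a_1)\mapsto M(a_0,\omega a_1)$. Then $\mathcal{S}_1$ and $\mathcal{S}_\alpha$ are disjoint if $q$ is odd, and if $q$ is even they meet only in points of the common nuclear plane of $\mathcal{V}_1$ and $\mathcal{V}_\alpha$.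
   Context: $\mathcal{V}_1$ is the standard Veronese variety of $\mathrm{PG}(W)$ and $\mathcal{S}_1$ its chordal variety (points whose matrix has rank at most $2$). For $q$ even, the nuclear plane of a Veronese surface of $\mathrm{PG}(5,q)$ is the plane containing the nuclei of all its conics; for $\mathcal{V}_1$ and for $\mathcal{V}_\alpha$ it is the plane consisting of the points spanned by $M(0,a_1)$, $a_1\in F^*$. *)

(* Defs.v *)
From HB Require Import structures.
From mathcomp Require Import all_boot all_order all_algebra all_field.
Set Implicit Arguments.
Unset Strict Implicit.
Unset Printing Implicit Defensive.
Import GRing.Theory VectorInternalTheory.
Local Open Scope ring_scope.

(* 3 x 3 matrices over F, as a vector space over the subfield K.  This is a
   separate name because 'M[F]_3 itself canonically is a vector space over F. *)
Definition mx3 (K : fieldType) (F : fieldExtType K) : Type := 'M[F]_3.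

Section RestrictScalars.
Variables (K : fieldType) (F : fieldExtType K).

HB.instance Definition _ := GRing.Zmodule.on (mx3 F).

Definition mx3_scale (c : K) (A : mx3 F) : mx3 F :=
  \matrix_(i, j) (c *: (A : 'M[F]_3) i j).

Fact mx3_scaleA a b A : mx3_scale a (mx3_scale b A) = mx3_scale (a * b) A.
Proof. by apply/matrixP=> i j; rewrite !mxE scalerA. Qed.
Fact mx3_scale1 : left_id 1 mx3_scale.
Proof. by move=> A; apply/matrixP=> i j; rewrite !mxE scale1r. Qed.
Fact mx3_scaleDr : right_distributive mx3_scale +%R.
Proof. by move=> a A B; apply/matrixP=> i j; rewrite !mxE scalerDr. Qed.
Fact mx3_scaleDl A : {morph mx3_scale^~ A : a b / a + b}.
Proof. by move=> a b; apply/matrixP=> i j; rewrite !mxE scalerDl. Qed.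

HB.instance Definition _ := GRing.Zmodule_isLmodule.Build K (mx3 F)
  mx3_scaleA mx3_scale1 mx3_scaleDr mx3_scaleDl.

Fact mx3_vect_iso : Vector.axiom (dim {ffun 'I_3 * 'I_3 -> F}) (mx3 F).
Proof.
pose f (A : mx3 F) : {ffun 'I_3 * 'I_3 -> F} :=
  [ffun p => (A : 'M[F]_3) p.1 p.2].
pose g (h : {ffun 'I_3 * 'I_3 -> F}) : mx3 F := \matrix_(i, j) h (i, j).
have fK : cancel f g by move=> A; apply/matrixP=> i j; rewrite !mxE ffunE.
have gK : cancel g f by move=> h; apply/ffunP=> -[i j]; rewrite ffunE mxE.
exists (fun A => v2r (f A)).
  move=> c A B /=; rewrite -linearP; congr (v2r _).
  by apply/ffunP=> p; rewrite !ffunE !mxE.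
exists (fun r => g (r2v r)) => x.
  by rewrite v2rK fK.
by rewrite gK r2vK.
Qed.

HB.instance Definition _ := Lmodule_hasFinDim.Build K (mx3 F) mx3_vect_iso.

End RestrictScalars.

(* Projective geometry of a K-vector space: points, lines, planes are the
   subspaces of dimension 1, 2, 3; a set of points is a predicate on subspaces. *)
Section Conics.
Variables (K : fieldType) (vT : vectType K).
Implicit Types (E pi l P N : {vspace vT}) (C V : {vspace vT} -> Prop).

Definition polar (f : vT -> K) (v w : vT) : K := f (v + w) - f v - f w.

Definition quadratic_form (f : vT -> K) : Prop :=
  (forall c v, f (c *: v) = c ^+ 2 * f v) /\ (forall v, scalar (polar f v)).

(* Over a finite field a singular ternary form has a rational singular point,
   so rational vectors suffice here, also in characteristic 2. *)
Definition nonsingular_on pi (f : vT -> K) : Prop :=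
  forall v, v \in pi -> f v = 0 ->
    (forall w, w \in pi -> polar f v w = 0) -> v = 0.

Definition is_conic pi C : Prop :=
  exists f, [/\ quadratic_form f, nonsingular_on pi f &
    forall P, C P <->
      [/\ \dim P = 1%N, (P <= pi)%VS & forall v, v \in P -> f v = 0]].

Definition tangent_line pi C l : Prop :=
  [/\ \dim l = 2%N, (l <= pi)%VS & exists! P, C P /\ (P <= l)%VS].

Definition is_nucleus pi C N : Prop :=
  [/\ \dim N = 1%N, (N <= pi)%VS & forall l, tangent_line pi C l -> (N <= l)%VS].

Definition is_plane E pi : Prop := \dim pi = 3%N /\ (pi <= E)%VS.

Definition contains_nuclei E V U : Prop :=
  forall pi C N, is_plane E pi -> is_conic pi C -> (forall P, C P -> V P) ->
    is_nucleus pi C N -> (N <= U)%VS.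

Definition is_nuclear_plane E V pi : Prop :=
  [/\ is_plane E pi, contains_nuclei E V pi &
    forall pi', is_plane E pi' -> contains_nuclei E V pi' -> pi' = pi].

End Conics.

Section TwistedVeronese.
Variables (K : finFieldType) (F : fieldExtType K).
Local Notation q := #|K|.

Definition M (a0 a1 : F) : mx3 F :=
  \matrix_(i < 3, j < 3)
    nth 0 (nth [::] [:: [:: a0;            a1;       a1 ^+ (q ^ 2)];
                        [:: a1;            a0 ^+ q;  a1 ^+ q];
                        [:: a1 ^+ (q ^ 2); a1 ^+ q;  a0 ^+ (q ^ 2)]] i) j.

Definition M_pair (a : F * F) : mx3 F := M a.1 a.2.

Fact frob_linear n (c : K) (x y : F) :
  (c *: x + y) ^+ (q ^ n) = c *: x ^+ (q ^ n) + y ^+ (q ^ n).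
Proof.
have cq : c ^+ (q ^ n) = c.
  by elim: n => [|n IH]; rewrite ?expn0 ?expr1 // expnS exprM expf_card IH.
have [p p_pr pcharK] := finPcharP K.
have pcharF : p \in [pchar F] by rewrite pchar_lalg.
have qn_p : [pchar F].-nat (q ^ n)%N.
  rewrite (eq_pnat _ (pcharf_eq pcharF)) (card_pprimeChar pcharK) -expnM.
  by rewrite pnatX pnat_id.
by rewrite (exprDn_pchar _ _ qn_p) exprZn cq.
Qed.

Fact M_pair_is_linear : linear M_pair.
Proof.
move=> c a b; apply/matrixP=> i j; rewrite !mxE /=.
have f1 := @frob_linear 1; rewrite expn1 in f1.
by case: i j => [[|[|[|//]]] ?] [[|[|[|//]]] ?] /=; rewrite ?f1 ?frob_linear.
Qed.

HB.instance Definition _ :=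
  GRing.isLinear.Build K (F * F)%type (mx3 F) _ M_pair M_pair_is_linear.

Definition W : {vspace mx3 F} := limg (linfun M_pair).

Definition veronese (w : F) (P : {vspace mx3 F}) : Prop :=
  exists2 x : F, x != 0 & P = <[M (x ^+ 2) (w * x ^+ q.+1)]>%VS.

Definition chordal1 (P : {vspace mx3 F}) : Prop :=
  exists a0 a1 : F, [/\ M a0 a1 != 0, \det (M a0 a1 : 'M[F]_3) = 0 &
                        P = <[M a0 a1]>%VS].

(* The image of chordal1 under the projectivity M a0 a1 |-> M a0 (w * a1). *)
Definition chordal (w : F) (P : {vspace mx3 F}) : Prop :=
  exists a0 a1 : F, chordal1 <[M a0 a1]>%VS /\ P = <[M a0 (w * a1)]>%VS.

End TwistedVeronese.

(* Main.v *)
(* Here det M(a0,a1) = N(a0) + 2 N(a1) - Tr(a0^(q^2) a1^2).  A common point of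
   S_1 and S_alpha satisfies this equation for (a0,a1) and for (a0,alpha a1).
   For alpha = -1 the difference is 4 N(a1).  In characteristic 2 both equations
   equate N(a0) to a multiple of the same trace, by the factors 1 and alpha^2,
   so N(a0) = 0 and the point is M(0,a1).

   Nuclear plane, q even.  Write v(x) = M(x^2, w x^(q+1)).  Then
   v(s x + t y) = s^2 v(x) + t^2 v(y) + s t M(0, w (x y^q + y x^q)), so
   the K-lines <x,y> of F give conics with nucleus M(0, w (x y^q + y x^q)), and
   three of these nuclei span {M(0,a1)}.  Conversely, a nonsingular conic has at
   least 4 points because q > 2, while the span of v(x), v(y), v(z) for
   independent x, y, z contains only those 3 Veronese points.  Hence every conic
   on the Veronese surface comes from a line of F, and two of its tangents meet in
   M(0, w (x y^q + y x^q)). *)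
Require Import Defs.
From mathcomp Require Import all_boot all_order all_algebra all_field ring.
Set Implicit Arguments.
Unset Strict Implicit.
Unset Printing Implicit Defensive.
Import GRing.Theory.
Local Open Scope ring_scope.

(** * Explicit coordinates in spans of two or three vectors *)

Section SmallSpans.
Variables (K : fieldType) (vT : vectType K).
Implicit Types (u v w x y z : vT) (U : {vspace vT}).

Lemma span2P v x y :
  reflect (exists a b, v = a *: x + b *: y) (v \in <<[:: x; y]>>%VS).
Proof.
rewrite span_cons span_seq1; apply: (iffP memv_addP) => [|[a [b ->]]].
  by move=> [_ /vlineP[a ->] [_ /vlineP[b ->] ->]]; exists a, b.
by exists (a *: x); [|exists (b *: y)]; rewrite ?memvZ ?memv_line.
Qed.

Lemma span3P v x y z :
  reflect (exists a b c, v = a *: x + b *: y + c *: z)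
          (v \in <<[:: x; y; z]>>%VS).
Proof.
rewrite span_cons; apply: (iffP memv_addP) => [|[a [b [c ->]]]].
  move=> [_ /vlineP[a ->] [_ /span2P[b [c ->]] ->]].
  by exists a, b, c; rewrite addrA.
exists (a *: x); first by rewrite memvZ ?memv_line.
by exists (b *: y + c *: z); rewrite ?addrA //; apply/span2P; exists b, c.
Qed.

Lemma free2P x y :
  reflect (forall a b, a *: x + b *: y = 0 -> a = 0 /\ b = 0)
          (free [:: x; y]).
Proof.
apply: (iffP (@freeP _ _ 2 [tuple x; y])) => [fr a b e0|fr k].
  have := fr (fun i => nth 0 [:: a; b] i).
  rewrite !big_ord_recl big_ord0 addr0 /= => /(_ e0) k0.
  by split; [apply: (k0 0) | apply: (k0 1)].
rewrite !big_ord_recl big_ord0 addr0 /= => /fr[k0 k1] i.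
by case: i => [[|[|//]] ?]; [rewrite -[RHS]k0|rewrite -[RHS]k1];
  congr k; apply: val_inj.
Qed.

Lemma free3P x y z :
  reflect (forall a b c, a *: x + b *: y + c *: z = 0 ->
             [/\ a = 0, b = 0 & c = 0])
          (free [:: x; y; z]).
Proof.
apply: (iffP (@freeP _ _ 3 [tuple x; y; z])) => [fr a b c e0|fr k].
  have := fr (fun i => nth 0 [:: a; b; c] i).
  rewrite !big_ord_recl big_ord0 addr0 addrA /= => /(_ e0) k0.
  by split; [apply: (k0 0) | apply: (k0 1) | apply: (k0 (1 + 1))].
rewrite !big_ord_recl big_ord0 addr0 addrA /= => /fr[k0 k1 k2] i.
case: i => [[|[|[|//]]] ?]; [rewrite -[RHS]k0|rewrite -[RHS]k1|rewrite -[RHS]k2];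
  by congr k; apply: val_inj.
Qed.

(** Dimension count; it serves to extend a free family one vector at a time. *)
Lemma exists_outside U (X : seq vT) :
  (size X < \dim U)%N -> exists2 u, u \in U & u \notin <<X>>%VS.
Proof.
move=> szX; apply/subvPn; apply: contraL szX => /dimvS le; rewrite -leqNgt.
exact: leq_trans le (dim_span X).
Qed.

Lemma free_span_dim U (X : seq vT) :
  free X -> {subset X <= U} -> \dim U = size X -> U = <<X>>%VS.
Proof.
move=> frX /span_subvP sXU dU; apply/esym/eqP.
by rewrite eqEdim sXU dU (eqP frX) leqnn.
Qed.

Lemma vline_eqP u v : v != 0 -> <[u]>%VS = <[v]>%VS ->
  exists2 k, k != 0 & u = k *: v.
Proof.
move=> v0 e; have /vlineP[k ek] : u \in <[v]>%VS by rewrite -e memv_line.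
exists k => //; have := congr1 (@dimv K vT) e; rewrite !dim_vline v0 ek.
by apply: contra_eq_neq => ->; rewrite scale0r eqxx.
Qed.

Lemma vlineZ k v : k != 0 -> <[k *: v]>%VS = <[v]>%VS.
Proof.
move=> k0; apply/eqP; rewrite eqEsubv -!memvE memvZ ?memv_line //=.
by apply/vlineP; exists k^-1; rewrite scalerA mulVf ?scale1r.
Qed.

Lemma dim1_vline P : \dim P = 1%N -> exists2 v : vT, v != 0 & P = <[v]>%VS.
Proof.
move=> dP; have nzP : (P != 0)%VS by rewrite -dimv_eq0 dP.
exists (vpick P); first by rewrite vpick0.
apply/esym/eqP; rewrite eqEdim dP dim_vline vpick0 nzP andbT.
by rewrite -memvE memv_pick.
Qed.

End SmallSpans.

(** * Finite fields of even order *)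

Lemma char2_card (K : finFieldType) : (2 \in [pchar K]) = ~~ odd #|K|.
Proof.
have [p p_pr cp] := finPcharP K; have := finNzRing_gt1 K.
rewrite (pcharf_eq cp) (card_pprimeChar cp) oddX !inE.
case: (logn _ _) => [|n] //= _; apply/eqP/idP => [<- //|].
by case: (even_prime p_pr) => [-> | ->].
Qed.

(** With q even, the square of c^(q/2) is c^q = c. *)
Lemma sqrt_char2 (K : finFieldType) (c : K) : 2 \in [pchar K] ->
  exists s, c = s ^+ 2.
Proof.
move=> c2; exists (c ^+ (#|K|./2)); rewrite -exprM muln2 even_halfK ?expf_card //.
by rewrite -char2_card.
Qed.

(** * Ternary quadratic forms in characteristic 2 *)

Section QuadraticFormChar2.
Variables (K : finFieldType) (vT : vectType K) (f : vT -> K).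
Hypotheses (char2 : 2 \in [pchar K]) (qf : quadratic_form f).
Implicit Types (v w : vT) (pi : {vspace vT}).

Lemma polar_sym v w : polar f v w = polar f w v.
Proof. by rewrite /polar (addrC v) addrAC. Qed.

Lemma quadraticD v w : f (v + w) = f v + f w + polar f v w.
Proof. by rewrite /polar; ring. Qed.

Lemma polarDr v w w' : polar f v (w + w') = polar f v w + polar f v w'.
Proof. by have [_ lin] := qf; rewrite -(scale1r w) lin mul1r !scale1r. Qed.

Lemma polarZr v a w : polar f v (a *: w) = a * polar f v w.
Proof.
have [_ lin] := qf; have p0 : polar f v 0 = 0.
  by have := lin v (-1) 0 0; rewrite scaler0 addr0 mulN1r addNr.
by rewrite -[a *: w]addr0 lin p0 addr0.
Qed.

Lemma polar_alt v : polar f v v = 0.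
Proof.
have [sc _] := qf; rewrite /polar -{1 2}(scale1r v) -scalerDl sc.
by rewrite (addrr_pchar2 char2) expr0n mul0r sub0r -opprD (addrr_pchar2 char2) oppr0.
Qed.

(* An alternating form in odd dimension is degenerate. *)
Lemma exists_polar_radical pi : \dim pi = 3%N ->
  exists n, [/\ n \in pi, n != 0 & forall w, w \in pi -> polar f n w = 0].
Proof.
move=> dpi.
have [e1 p1 n1] : exists2 u, u \in pi & u \notin <<[::]>>%VS.
  by apply: exists_outside; rewrite dpi.
have [e2 p2 n2] : exists2 u, u \in pi & u \notin <<[:: e1]>>%VS.
  by apply: exists_outside; rewrite dpi.
have [e3 p3 n3] : exists2 u, u \in pi & u \notin <<[:: e2; e1]>>%VS.
  by apply: exists_outside; rewrite dpi.
have fr : free [:: e3; e2; e1] by rewrite !free_cons n1 n2 n3 nil_free.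
have epi : pi = <<[:: e3; e2; e1]>>%VS.
  apply: free_span_dim => // u; rewrite !inE.
  by case/or3P=> /eqP->.
have rad n : n \in pi -> polar f e1 n = 0 -> polar f e2 n = 0 ->
    polar f e3 n = 0 -> forall w, w \in pi -> polar f n w = 0.
  move=> _ r1 r2 r3 w; rewrite epi => /span3P[a [b [c ->]]].
  by rewrite !polarDr !polarZr !(polar_sym n) r1 r2 r3 !mulr0 !addr0.
have D := addrr_pchar2 char2.
(* The coefficient of each basis vector is the polar value of the other two: these Pfaffians span
   the kernel of an alternating 3 x 3 matrix, and signs are immaterial here. If all of them vanish,
   so does the polar form on [pi], and [e1] will do. *)
pose n := polar f e2 e1 *: e3 + polar f e3 e1 *: e2 + polar f e3 e2 *: e1.
have [n0|n0] := eqVneq n 0.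
  have [b21 b31 b32] := free3P _ _ _ fr _ _ _ n0.
  exists e1; split; rewrite // -?memv0 -?span_nil //.
  by apply: rad; rewrite ?polar_alt.
exists n; split=> //; first by rewrite !memvD ?memvZ.
apply: rad; first (by rewrite !memvD ?memvZ);
  rewrite /n !polarDr !polarZr !polar_alt ?(polar_sym e1) ?(polar_sym e2 e3);
  rewrite mulr0 ?addr0 ?add0r mulrC D //.
Qed.

(** Take n in the radical of the polar form; nonsingularity gives f(n) != 0. Since f(v + c n) = f(v)
    + c^2 f(n) and square roots exist, every coset of the line of n contains a zero. Four directions
    modulo n, available because q > 2, give four zeros. *)
Lemma nonsingular_four_zeros pi : (2 < #|K|)%N -> \dim pi = 3%N ->
  nonsingular_on pi f ->
  exists s : seq vT,
    [/\ size s = 4, pairwise (fun v w => free [:: v; w]) s &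
        forall v, v \in s -> v \in pi /\ f v = 0].
Proof.
move=> K_gt2 dpi ns; have [n [n_pi n0 rad]] := exists_polar_radical dpi.
have fn0 : f n != 0.
  by apply: contra_neq n0 => fn0; apply: ns => // w /rad.
have [u1 p1 n1] : exists2 u, u \in pi & u \notin <<[:: n]>>%VS.
  by apply: exists_outside; rewrite dpi.
have [u2 p2 n2] : exists2 u, u \in pi & u \notin <<[:: u1; n]>>%VS.
  by apply: exists_outside; rewrite dpi.
have fr : free [:: u2; u1; n].
  by rewrite !free_cons n1 n2 span_nil memv0 n0 nil_free.
have lift v : v \in pi -> exists c, f (v + c *: n) = 0.
  move=> v_pi; have [c ec] := sqrt_char2 (- f v / f n) char2.
  exists c; rewrite quadraticD (proj1 qf) -ec divfK // polarZr polar_sym.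
  by rewrite rad // mulr0 addr0 subrr.
have [t t0 t1] : exists2 t : K, t != 0 & t != 1.
  have : (0 < #|~: [set 0%R; 1%R : K]|)%N.
    by rewrite cardsCs setCK cards2 eq_sym oner_neq0 subn_gt0.
  by case/card_gt0P=> t; rewrite !inE negb_or => /andP[]; exists t.
(* Independence modulo n is enough, so the coefficients of n are arbitrary. *)
have ind a b c a' b' c' : a * b' - a' * b != 0 ->
    free [:: a *: u2 + b *: u1 + c *: n; a' *: u2 + b' *: u1 + c' *: n].
  move=> nz; apply/free2P => x y e0.
  move: e0; rewrite !scalerDr !scalerA addrACA [X in X + _]addrACA -!scalerDl.
  case/(free3P _ _ _ fr) => e1 e2 _.
  split; apply: (mulIf nz); rewrite mul0r.
    by transitivity (b' * 0 - a' * 0); [rewrite -{1}e1 -e2|]; ring.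
  by transitivity (a * 0 - b * 0); [rewrite -{1}e2 -e1|]; ring.
have {}lift a b : exists c, f (a *: u2 + b *: u1 + c *: n) = 0.
  by apply: lift; rewrite memvD ?memvZ.
have [c1 z1] := lift 0 1; have [c2 z2] := lift 1 0.
have [c3 z3] := lift 1 1; have [c4 z4] := lift 1 t.
exists [:: 0 *: u2 + 1 *: u1 + c1 *: n; 1 *: u2 + 0 *: u1 + c2 *: n;
           1 *: u2 + 1 *: u1 + c3 *: n; 1 *: u2 + t *: u1 + c4 *: n].
split=> //; last first.
  move=> v; rewrite !inE; case/or4P=> /eqP->; split=> //;
    by rewrite !memvD // memvZ.
rewrite /= !andbT !ind // ?mul0r ?mulr0 ?mulr1 ?mul1r ?sub0r ?subr0;
  by rewrite ?oppr_eq0 ?oner_neq0 ?subr_eq0.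
Qed.

End QuadraticFormChar2.

Lemma sqr_inj_char2 (K : fieldType) : 2 \in [pchar K] ->
  injective (fun x : K => x ^+ 2).
Proof.
by move=> c2 x y e; apply: (fmorph_inj (pFrobenius_aut c2)); exact: e.
Qed.

(** * The conic z^2 = xy and its nucleus *)

Section StandardConic.
Variables (K : finFieldType) (vT : vectType K) (v1 v2 b : vT).
Hypotheses (char2 : 2 \in [pchar K]) (fr : free [:: v1; v2; b]).

(** Parametrisation of z^2 = xy in the coordinates x, y, z along [v1], [v2], [b]. The Veronese map
    takes this form on a K-line of F, see [verD]. *)
Definition conic_point (s t : K) : vT := s ^+ 2 *: v1 + t ^+ 2 *: v2 + (s * t) *: b.

Definition standard_conic (P : {vspace vT}) : Prop :=
  exists s t, (s, t) != (0, 0) /\ P = <[conic_point s t]>%VS.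

Let X := [tuple v1; v2; b].
Local Notation c0 := (coord X 0).
Local Notation c1 := (coord X 1).
Local Notation c2 := (coord X (1 + 1)).

Let coordE (x y z : K) (v := x *: v1 + y *: v2 + z *: b) :
  [/\ c0 v = x, c1 v = y & c2 v = z].
Proof.
have e : v = \sum_(i < 3) nth 0 [:: x; y; z] i *: X`_i.
  by rewrite !big_ord_recl big_ord0 addr0 addrA.
by rewrite e; split; rewrite coord_sum_free.
Qed.

Let f v := c2 v ^+ 2 - c0 v * c1 v.

Let polarE v w : polar f v w = - (c0 v * c1 w + c1 v * c0 w).
Proof.
rewrite /polar /f !linearD /=.
transitivity (c2 v * c2 w + c2 v * c2 w - (c0 v * c1 w + c1 v * c0 w)); first ring.
by rewrite (addrr_pchar2 char2) add0r.
Qed.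

Let quadratic_f : quadratic_form f.
Proof.
split=> [c v|v c w w']; first by rewrite /f !linearZ /=; ring.
by rewrite !polarE !linearP /=; ring.
Qed.

Lemma conic_point_eq0 s t : (conic_point s t == 0) = ((s, t) == (0, 0)).
Proof.
apply/eqP/eqP => [/(free3P _ _ _ fr)[/eqP + /eqP +] _|[-> ->]].
  by rewrite !expf_eq0 => /eqP-> /eqP->.
by rewrite /conic_point expr0n mulr0 !scale0r !addr0.
Qed.

Let f_conic_point s t : f (conic_point s t) = 0.
Proof.
by rewrite /f /conic_point; have [-> -> ->] := coordE (s ^+ 2) (t ^+ 2) (s * t); ring.
Qed.

(** Writing x = s^2 and y = t^2 turns the equation into z^2 = (s t)^2, and squaring is injective. *)
Let zeroP v : v \in <<[:: v1; v2; b]>>%VS -> f v = 0 ->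
  exists s t, v = conic_point s t.
Proof.
case/span3P=> x [y [z ->]]; rewrite /f; have [-> -> ->] := coordE x y z.
have [s ->] := sqrt_char2 x char2; have [t ->] := sqrt_char2 y char2.
move/eqP; rewrite -exprMn subr_eq0 => /eqP/(sqr_inj_char2 char2)->.
by exists s, t.
Qed.

Lemma standard_conicP : is_conic <<[:: v1; v2; b]>> standard_conic.
Proof.
have m1 : v1 \in <<[:: v1; v2; b]>>%VS by rewrite memv_span ?inE ?eqxx.
have m2 : v2 \in <<[:: v1; v2; b]>>%VS by rewrite memv_span ?inE ?eqxx ?orbT.
have m3 : b \in <<[:: v1; v2; b]>>%VS by rewrite memv_span ?inE ?eqxx ?orbT.
exists f; split=> //.
  move=> v v_pi /(zeroP v_pi)[s [t ->]] sing.
  apply/eqP; rewrite conic_point_eq0.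
  have := sing v1 m1; have := sing v2 m2; rewrite !polarE /conic_point.
  have [-> -> _] := coordE (s ^+ 2) (t ^+ 2) (s * t).
  have := coordE 1 0 0; rewrite !scale0r !scale1r !addr0 => -[-> -> _].
  have := coordE 0 1 0; rewrite !scale0r !scale1r !addr0 add0r => -[-> -> _].
  rewrite !mulr0 !mulr1 addr0 add0r => /eqP + /eqP.
  by rewrite !oppr_eq0 !expf_eq0 => /eqP-> /eqP->.
move=> P; split=> [[s [t [st0 ->]]]|[dP P_pi fP]].
  split.
  - by rewrite dim_vline conic_point_eq0 st0.
  - by rewrite -memvE !memvD ?memvZ.
  by move=> _ /vlineP[k ->]; rewrite (proj1 quadratic_f) f_conic_point mulr0.
have [v v0 eP] := dim1_vline dP.
have v_pi : v \in <<[:: v1; v2; b]>>%VS by rewrite memvE -eP.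
have fv : f v = 0 by apply: fP; rewrite eP memv_line.
have [s [t ev]] := zeroP v_pi fv; exists s, t; split; last by rewrite -ev.
by rewrite -conic_point_eq0 -ev.
Qed.

(** A tangent at p consists of vectors polar to p. The polar form ignores the [b]-coordinate, so
    such a vector has its first two coordinates proportional to those of p and differs from a
    multiple of p by a multiple of [b]. *)
Lemma standard_conic_nucleus :
  is_nucleus <<[:: v1; v2; b]>> standard_conic <[b]>.
Proof.
split.
- by rewrite dim_vline (free_not0 fr) // !inE eqxx !orbT.
- by rewrite -memvE memv_span // !inE eqxx !orbT.
move=> l [dl l_pi [_ [[[s [t [st0 ->]]] Pl] uniqP]]].
set p := conic_point s t in Pl uniqP.
have pl : p \in l by rewrite memvE.
have [u ul un] : exists2 u, u \in l & u \notin <<[:: p]>>%VS.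
  by apply: exists_outside; rewrite dl.
rewrite span_seq1 in un.
have u_pi := subvP l_pi _ ul; have p_pi := subvP l_pi _ pl.
(* Otherwise the line would meet the conic in a second point. *)
have pol0 : polar f p u = 0.
  apply/eqP/negPn/negP => nz.
  (* Since f(p) = 0, f(u + k p) = f(u) + k polar(p, u); this k makes it zero. *)
  pose k := - f u / polar f p u; pose u' := u + k *: p.
  have u'l : u' \in l by rewrite memvD ?memvZ.
  have fu' : f u' = 0.
    rewrite (quadraticD f) (proj1 quadratic_f) f_conic_point polarZr //.
    by rewrite (polar_sym _ u) divfK // mulr0 addr0 subrr.
  have [s' [t' e']] := zeroP (subvP l_pi _ u'l) fu'.
  have u'n : u' \notin <[p]>%VS.
    by apply: contra un => u'p; rewrite -(addrK (k *: p) u) memvB ?memvZ ?memv_line.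
  have eP : <[p]>%VS = <[u']>%VS.
    apply: uniqP; split; last by rewrite -memvE.
    exists s', t'; split; last by rewrite e'.
    by rewrite -conic_point_eq0 -e'; apply: contraNneq u'n => ->; rewrite mem0v.
  by rewrite eP memv_line in u'n.
(* Here z cannot be 0, as u lies outside the line of p; hence [b] is in l. *)
have fromK k z : u - k *: p = z *: b -> (<[b]> <= l)%VS.
  move=> e; have [z0|z0] := eqVneq z 0.
    by rewrite -(subrK (k *: p) u) e z0 scale0r add0r memvZ ?memv_line in un.
  rewrite -(vlineZ b z0) -memvE -e.
  by rewrite memvB ?memvZ.
have [x [y [z eu]]] := span3P _ _ _ _ u_pi.
move: pol0; rewrite polarE eu /p /conic_point.
have [-> -> _] := coordE (s ^+ 2) (t ^+ 2) (s * t).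
have [-> -> _] := coordE x y z.
move/eqP; rewrite oppr_eq0 addr_eq0 (oppr_pchar2 char2) => /eqP exy.
have {}fromK k z' : x = k * s ^+ 2 -> y = k * t ^+ 2 -> z = z' + k * (s * t) ->
    (<[b]> <= l)%VS.
  move=> ex ey ez; apply: (fromK k z'); rewrite eu ex ey ez /p /conic_point.
  by rewrite !scalerDr !scalerA scalerDl [in LHS](addrCA _ (z' *: b)) addrK.
(* The relation [exy] makes (x, y) proportional to (s^2, t^2); the factor k is read off from a
   nonzero coordinate. *)
have [s0|s0] := eqVneq s 0.
  have t0 : t != 0 by move: st0; rewrite s0 xpair_eqE eqxx.
  apply: (fromK (y / t ^+ 2) z); last by rewrite s0 mul0r mulr0 addr0.
    move/eqP: exy; rewrite s0 expr0n mul0r mulr0 eq_sym mulf_eq0 expf_eq0.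
    by rewrite (negPf t0) => /eqP.
  by rewrite divfK // expf_neq0.
apply: (fromK (x / s ^+ 2) (z - x / s ^+ 2 * (s * t))).
- by rewrite divfK // expf_neq0.
- by rewrite mulrAC [x * _]mulrC -exy mulrAC mulfV ?mul1r // expf_neq0.
- by rewrite subrK.
Qed.

End StandardConic.

(** * The matrices M(a0, a1) and the common points of the chordal varieties *)

Section TwistedMatrices.
Variables (K : finFieldType) (F : fieldExtType K).
Local Notation q := #|K|.
Implicit Types (k : K) (x y z a b : F) (P : {vspace mx3 F}).

Lemma frobD x y : (x + y) ^+ q = x ^+ q + y ^+ q.
Proof. by have := frob_linear 1 1 x y; rewrite expn1 !scale1r. Qed.

Lemma frobZ n k x : (k *: x) ^+ (q ^ n) = k *: x ^+ (q ^ n).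
Proof.
have := frob_linear n k x 0; rewrite !addr0 expr0n.
by rewrite gtn_eqF ?addr0 // expn_gt0 (ltnW (finNzRing_gt1 K)).
Qed.

Lemma frobZ1 k x : (k *: x) ^+ q = k *: x ^+ q.
Proof. by have := frobZ 1 k x; rewrite expn1. Qed.

(** The line K.1 is a subfield of dimension 1, whose elements are the roots of x^q = x. *)
Lemma frob_fixed x : x ^+ q = x -> exists k, x = k%:A.
Proof.
move=> e; apply/vlineP; have := Fermat's_little_theorem (1%AS : {subfield F}) x.
by rewrite dimv1 expn1 e eqxx.
Qed.

Lemma MD a0 a1 b0 b1 : M a0 a1 + M b0 b1 = M (a0 + b0) (a1 + b1).
Proof. exact/esym/(linearD (@M_pair K F) (a0, a1) (b0, b1)). Qed.

Lemma MZ k a0 a1 : k *: M a0 a1 = M (k *: a0) (k *: a1).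
Proof. exact/esym/(linearZ_LR (@M_pair K F) k (a0, a1)). Qed.

Lemma M_inj a0 a1 b0 b1 : M a0 a1 = M b0 b1 -> a0 = b0 /\ a1 = b1.
Proof.
move/matrixP=> e; have := e 0 0; have := e 0 1.
by rewrite !mxE.
Qed.

Lemma M00 : M 0 0 = 0 :> mx3 F.
Proof. exact: (linear0 (@M_pair K F)). Qed.

Lemma M_in_W a0 a1 : M a0 a1 \in W F.
Proof.
have := memv_img (linfun (@M_pair K F)) (memvf (a0, a1)).
by rewrite lfunE.
Qed.

Lemma det_M a0 a1 : \det (M a0 a1 : 'M[F]_3) =
  a0 * a0 ^+ q * a0 ^+ (q ^ 2) + a1 * a1 ^+ q * a1 ^+ (q ^ 2) *+ 2
  - (a0 * (a1 ^+ q) ^+ 2 + a0 ^+ q * (a1 ^+ (q ^ 2)) ^+ 2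
     + a0 ^+ (q ^ 2) * a1 ^+ 2).
Proof.
rewrite (expand_det_row _ 0) !big_ord_recl big_ord0 /cofactor.
rewrite !(expand_det_row _ 0) !big_ord_recl !big_ord0 /cofactor !det_mx11.
rewrite !mxE /= /bump /=; ring.
Qed.

(** [chordal1] only provides some spanning matrix; any other one is a nonzero K-multiple k of it,
    and the determinant is multiplied by k^3. *)
Lemma chordal1P a0 a1 :
  chordal1 <[M a0 a1]> -> M a0 a1 != 0 /\ \det (M a0 a1 : 'M[F]_3) = 0.
Proof.
case=> b0 [b1 [nz d0 e]].
have [k k0 ek] := vline_eqP nz e.
split; first by rewrite ek scaler_eq0 negb_or k0.
have -> : M a0 a1 = k%:A *: (M b0 b1 : 'M[F]_3).
  by rewrite ek; apply/matrixP=> i j; rewrite !mxE mulr_algl.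
by rewrite detZ d0 mulr0.
Qed.

(** Reduces a common point to two determinant equations in one pair (a0, a1), the point itself being
    spanned by M(a0, w a1). *)
Lemma chordal_both w P : w != 0 -> chordal1 P -> chordal w P ->
  exists a0 a1, [/\ M a0 (w * a1) != 0, \det (M a0 a1 : 'M[F]_3) = 0,
    \det (M a0 (w * a1) : 'M[F]_3) = 0 & P = <[M a0 (w * a1)]>%VS].
Proof.
move=> w0 c1 [a0 [a1 [ca eP]]]; exists a0, a1; rewrite eP in c1.
by have [_ ?] := chordal1P ca; have [? ?] := chordal1P c1.
Qed.

Lemma norm_eq0 x : x * x ^+ q * x ^+ (q ^ 2) = 0 -> x = 0.
Proof.
move/eqP; rewrite !mulf_eq0 !expf_eq0.
by case/orP=> [/orP[|/andP[]]|/andP[]] *; apply/eqP.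
Qed.

Lemma chordal_disjoint_odd P : odd q -> ~ (chordal1 P /\ chordal (-1)%:A P).
Proof.
move=> oq [c1 c2].
have w0 : (-1)%:A != 0 :> F by rewrite scaler_eq0 oppr_eq0 !oner_eq0.
have [a0 [a1 [nz d1 d2 _]]] := chordal_both w0 c1 c2.
have frobN n : (- a1) ^+ (q ^ n) = - a1 ^+ (q ^ n) by rewrite -scaleN1r frobZ scaleN1r.
have frobN1 : (- a1) ^+ q = - a1 ^+ q by have := frobN 1%N; rewrite expn1.
rewrite scaleN1r mulN1r in nz d2.
have two0 : 2%:R != 0 :> F.
  apply: contraL oq => two0; rewrite -char2_card -(pchar_lalg F) inE /=.
  by rewrite two0.
(* The trace terms are even in a1, so the two determinants differ by 4 N(a1); the factor 4 is
   cancelled as 2 times 2. *)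
have a10 : a1 = 0.
  apply: norm_eq0; apply: (mulfI two0); apply: (mulfI two0); rewrite !mulr0.
  rewrite -[RHS](subrr 0) -{1}d1 -d2 !det_M frobN frobN1; ring.
have z_q : (0 : F) ^+ q = 0 by have := frobZ1 0 0; rewrite !scale0r.
have z_q2 : (0 : F) ^+ (q ^ 2) = 0 by have := frobZ 2 0 0; rewrite !scale0r.
move: d1 nz; rewrite a10 oppr0 det_M z_q z_q2 expr0n /= !mulr0 mul0rn !addr0 subr0.
move/norm_eq0->.
by rewrite M00 eqxx.
Qed.

Lemma chordal_meet_even P (alpha : K) : 2 \in [pchar K] ->
  alpha != 0 -> alpha != 1 -> chordal1 P -> chordal alpha%:A P ->
  exists a1, P = <[M 0 a1]>%VS.
Proof.
move=> char2 al0 al1 c1 c2.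
have w0 : alpha%:A != 0 :> F by rewrite scaler_eq0 (negPf al0) oner_eq0.
have [a0 [a1 [nz d1 d2 ->]]] := chordal_both w0 c1 c2.
suff -> : a0 = 0 by exists (alpha%:A * a1).
apply: norm_eq0; set c := alpha%:A in d2 w0 *.
(* Squaring is injective in characteristic 2, so alpha^2 = 1 would force alpha = 1. *)
have c21 : c ^+ 2 != 1.
  apply: contra_neq al1 => /esym; rewrite -[X in X = _](expr1n F 2).
  have char2F : 2 \in [pchar F] by rewrite pchar_lalg.
  move/(sqr_inj_char2 char2F)/eqP; rewrite -[X in X == _]scale1r.
  by rewrite -subr_eq0 -scalerBl scaler_eq0 oner_eq0 orbF subr_eq0 => /eqP.
have addFF : forall x : F, x *+ 2 = 0.
  by move=> x; rewrite mulrn_pchar // pchar_lalg.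
have cq2 : (c * a1) ^+ (q ^ 2) = c * a1 ^+ (q ^ 2) by rewrite !mulr_algl frobZ.
have cq1 : (c * a1) ^+ q = c * a1 ^+ q by rewrite !mulr_algl frobZ1.
(* With X the norm of a0 and T the trace term, the equations read X = T and X = c^2 T, whence (1 -
   c^2) X = 0. *)
move: d1 d2; rewrite !det_M cq1 cq2 !addFF !addr0.
set X := a0 * _ * _; set T := a0 * (a1 ^+ q) ^+ 2 + _ + _ => d1 d2.
have dT : X = c ^+ 2 * T.
  by apply/eqP; rewrite -subr_eq0 -[X in _ == X]d2 /T; apply/eqP; ring.
have XT : X = T by apply/eqP; rewrite -subr_eq0 d1.
apply/eqP; move/eqP: dT; rewrite -XT -{1}[X]mul1r -subr_eq0 -mulrBl mulf_eq0.
by rewrite subr_eq0 eq_sym (negPf c21).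
Qed.

End TwistedMatrices.

(** * Conics on the Veronese surface and their nuclei, q even *)

Section NuclearPlane.
Variables (K : finFieldType) (F : fieldExtType K) (w : F).
Hypotheses (char2 : 2 \in [pchar K]) (w0 : w != 0).
Local Notation q := #|K|.
Implicit Types (k s t : K) (x y z : F)
  (P U N pi : {vspace mx3 F}) (C : {vspace mx3 F} -> Prop).

Let char2F : 2 \in [pchar F].
Proof. by rewrite pchar_lalg. Qed.

(** In characteristic 2 this is the Moore determinant x y^q - y x^q, an alternating K-bilinear
    map. *)
Definition wedge x y : F := x * y ^+ q + y * x ^+ q.
Definition ver x : mx3 F := M (x ^+ 2) (w * x ^+ q.+1).
Definition nuc x y : mx3 F := M 0 (w * wedge x y).

Lemma scale_in_alg k x : k *: x = in_alg F k * x.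
Proof. by rewrite in_algE mulr_algl. Qed.

Lemma wedgeC x y : wedge x y = wedge y x.
Proof. by rewrite /wedge addrC. Qed.

Lemma wedgeDl x y z : wedge (x + y) z = wedge x z + wedge y z.
Proof. by rewrite /wedge frobD; ring. Qed.

Lemma wedgeZl k x y : wedge (k *: x) y = k *: wedge x y.
Proof. by rewrite /wedge frobZ1 scalerDr -scalerAl -scalerAr. Qed.

Lemma wedgeDr x y z : wedge x (y + z) = wedge x y + wedge x z.
Proof. by rewrite !(wedgeC x) wedgeDl. Qed.

Lemma wedgeZr k x y : wedge x (k *: y) = k *: wedge x y.
Proof. by rewrite !(wedgeC x) wedgeZl. Qed.

Lemma wedgexx x : wedge x x = 0.
Proof. by rewrite /wedge (addrr_pchar2 char2F). Qed.

(** For y != 0 the vanishing says (x/y)^q = x/y, so x/y lies in K. *)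
Lemma wedge_eq0 x y : wedge x y = 0 -> ~~ free [:: x; y].
Proof.
move=> e; rewrite free_cons seq1_free; apply/negP => /andP[+ y0].
rewrite span_seq1 => /negP[].
have [k ek] : exists k, x / y = k%:A.
  apply: frob_fixed; rewrite exprMn exprVn; apply/eqP.
  rewrite eqr_div ?expf_neq0 // mulrC -(oppr_pchar2 char2F (x * _)) -addr_eq0.
  by rewrite addrC -/(wedge x y) e.
by apply/vlineP; exists k; rewrite -[x](divfK y0) ek mulr_algl.
Qed.

(* Every 2-vector of a 3-space is decomposable, so a relation between the three
   wedges would make the wedge of two independent vectors vanish. *)
Lemma free_wedge x y z :
  free [:: x; y; z] -> free [:: wedge x y; wedge x z; wedge y z].
Proof.
move=> /free3P fr; apply/free3P => a b c e.
have [a0|a0] := eqVneq a 0.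
  have e' : wedge (b *: x + c *: y) z = 0.
    by rewrite -[RHS]e a0 scale0r add0r wedgeDl !wedgeZl.
  have [b0|b0] := eqVneq b 0; have [c0|c0] := eqVneq c 0 => //;
    case/negP: (wedge_eq0 e'); apply/free2P => m n;
    rewrite scalerDr !scalerA => /fr[/eqP + /eqP + ->];
    by rewrite !mulf_eq0 ?(negPf b0) ?(negPf c0) ?orbF => /eqP + /eqP.
(* Decomposition of the given relation; expanding leaves only the extra term in wedge(z, z), which
   is 0. *)
have e' : wedge (x + (c / a) *: z) (a *: y + b *: z) = 0.
  rewrite -[RHS]e !wedgeDl !wedgeDr !wedgeZl !wedgeZr wedgexx !scaler0 addr0.
  by rewrite scalerA divfK // (wedgeC z).
case/negP: (wedge_eq0 e'); apply/free2P => m n.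
rewrite !scalerDr !scalerA addrACA -scalerDl => /fr[-> /eqP + _].
by rewrite mulf_eq0 (negPf a0) orbF => /eqP->.
Qed.

Lemma sqrD x y : (x + y) ^+ 2 = x ^+ 2 + y ^+ 2.
Proof. by rewrite sqrrD mulrn_pchar // addr0. Qed.

(** All coefficients are squares, so a combination of squares is the square of a combination. *)
Lemma free_sqr x y z :
  free [:: x; y; z] -> free [:: x ^+ 2; y ^+ 2; z ^+ 2].
Proof.
move=> /free3P fr; apply/free3P => a b c.
have [r ->] := sqrt_char2 a char2; have [s ->] := sqrt_char2 b char2.
have [t ->] := sqrt_char2 c char2.
rewrite -!exprZn -!sqrD => /eqP; rewrite expf_eq0 /= => /eqP/fr[-> -> ->].
by rewrite expr0n.
Qed.

Lemma verD s t x y :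
  ver (s *: x + t *: y) = conic_point (ver x) (ver y) (nuc x y) s t.
Proof.
rewrite /ver /nuc /conic_point !MZ !MD scaler0 addr0 -!exprZn sqrD.
congr M; rewrite exprS frobD !frobZ1 !scale_in_alg !rmorphM /= /wedge !exprS.
by ring.
Qed.

(** The first argument of [M] gives (s x + t y)^2 = 0 and kills two coefficients; the second then
    kills the last, because wedge(x, y) != 0. *)
Lemma free_conic x y : free [:: x; y] -> free [:: ver x; ver y; nuc x y].
Proof.
move=> fr; apply/free3P => a b c.
rewrite !MZ !MD scaler0 addr0 -M00 => /M_inj[].
have [s ->] := sqrt_char2 a char2; have [t ->] := sqrt_char2 b char2.
rewrite -!exprZn -!sqrD => /eqP; rewrite expf_eq0 /= => /eqP.
move/(free2P _ _ fr) => [-> ->]; rewrite expr0n !scale0r !add0r => /eqP.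
rewrite scaler_eq0 mulf_eq0 (negPf w0) /=; case: eqP => [-> //|_ /eqP/wedge_eq0].
by rewrite fr.
Qed.

Lemma verZ k x : ver (k *: x) = k ^+ 2 *: ver x.
Proof.
by rewrite /ver MZ exprZn !(exprS _ q) frobZ1 -scalerAl -!scalerAr scalerA -expr2.
Qed.

Lemma ver_eq0 x : (ver x == 0) = (x == 0).
Proof.
apply/eqP/eqP => [|->]; last by rewrite -(scale0r 0) verZ expr0n scale0r.
by rewrite -M00 => /M_inj[/eqP + _]; rewrite expf_eq0 => /eqP.
Qed.

Lemma standard_conic_ver x y P : free [:: x; y] ->
  standard_conic (ver x) (ver y) (nuc x y) P -> veronese w P.
Proof.
move=> /free2P fr [s [t [st0 ->]]]; rewrite -verD; exists (s *: x + t *: y) => //.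
by apply: contra_neq st0 => /fr[-> ->].
Qed.

(** Comparing first arguments of [M] gives z^2 = (k x)^2. Thus this line meets the Veronese surface
    in one point only. *)
Lemma ver_in_tangent z x y : ver z \in <<[:: ver x; nuc x y]>>%VS ->
  exists k, z = k *: x.
Proof.
case/span2P=> a [b]; rewrite !MZ MD scaler0 addr0 => /M_inj[+ _].
have [k ->] := sqrt_char2 a char2.
by rewrite -exprZn => /(sqr_inj_char2 char2F)->; exists k.
Qed.

(** Applied at two points of a conic, this supplies two tangents that confine its nucleus. *)
Lemma tangent_line_ver pi C x y : free [:: x; y] ->
  (forall P, C P -> veronese w P) -> C <[ver x]>%VS -> ver x \in pi ->
  nuc x y \in pi -> tangent_line pi C <<[:: ver x; nuc x y]>>%VS.
Proof.
move=> fr CV Cx x_pi n_pi.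
have frl : free [:: ver x; nuc x y].
  apply/free2P => a b e.
  have := free3P _ _ _ (free_conic fr) a 0 b; rewrite scale0r addr0 e.
  by case.
split; first by rewrite (eqP frl).
  by apply/span_subvP => v; rewrite !inE => /orP[]/eqP->.
exists <[ver x]>%VS; split.
  by split=> //; rewrite -memvE memv_span ?mem_head.
move=> P [/CV[z z0 ->]]; rewrite -memvE => /ver_in_tangent[k ek].
rewrite -/(ver z) ek verZ vlineZ // expf_neq0 //.
by apply: contraNneq z0 => k0; rewrite ek k0 scale0r.
Qed.

Lemma tangents_meet x y v : free [:: x; y] ->
  v \in <<[:: ver x; nuc x y]>>%VS -> v \in <<[:: ver y; nuc x y]>>%VS ->
  v \in <[nuc x y]>%VS.
Proof.
move=> fr /span2P[a [b ->]] /span2P[c [d e]].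
have := free3P _ _ _ (free_conic fr) a (- c) (b - d).
case.
  by rewrite scaleNr scalerBl addrACA e -opprD subrr.
by move=> -> _ _; rewrite scale0r add0r memvZ ?memv_line.
Qed.

(** First arguments give u = r x + s y + t z. In the second, the mixed terms form a relation between
    the three wedges; these are independent, so rs = rt = st = 0. *)
Lemma ver_in_span x y z u : free [:: x; y; z] ->
  ver u \in <<[:: ver x; ver y; ver z]>>%VS ->
  exists k, [\/ u = k *: x, u = k *: y | u = k *: z].
Proof.
move=> fr /span3P[a [b [c]]]; rewrite !MZ !MD => /M_inj[].
have [r ->] := sqrt_char2 a char2; have [s ->] := sqrt_char2 b char2.
have [t ->] := sqrt_char2 c char2.
rewrite -!exprZn -!sqrD => /(sqr_inj_char2 char2F)-> e.
have : (r * s) *: wedge x y + (r * t) *: wedge x z + (s * t) *: wedge y z = 0.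
  apply: (mulfI w0); rewrite mulr0 -[RHS](subrr (w * (r *: x + s *: y + t *: z) ^+ q.+1)) {2}e.
  rewrite exprS !frobD !frobZ1 !scale_in_alg !rmorphM /= /wedge !exprS.
  by ring.
case/(free3P _ _ _ (free_wedge fr)) => /eqP + /eqP + /eqP.
rewrite !mulf_eq0.
have [-> _ _|r0] := eqVneq r 0; last first.
  by move=> /= /eqP-> /eqP-> _; exists r; rewrite !scale0r !addr0; apply: Or31.
have [-> _|s0 /= /eqP->] := eqVneq s 0.
  by exists t; rewrite !scale0r !add0r; apply: Or33.
by exists s; rewrite !scale0r add0r addr0; apply: Or32.
Qed.

Lemma free_ver x y z : free [:: x; y; z] -> free [:: ver x; ver y; ver z].
Proof.
move=> /free_sqr/free3P fr; apply/free3P => a b c.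
by rewrite !MZ !MD -M00 => /M_inj[/fr].
Qed.

(** Four points of the conic lift to pairwise independent x1, ..., x4 in F. By [ver_in_span] the
    first three are dependent, so the plane contains [nuc x1 x2] and both tangents through it. *)
Lemma conic_in_veronese_nucleus pi C N : (2 < q)%N -> \dim pi = 3%N ->
  is_conic pi C -> (forall P, C P -> veronese w P) -> is_nucleus pi C N ->
  exists x y, (N <= <[nuc x y]>)%VS.
Proof.
move=> q_gt2 dpi [f [qf ns Cdef]] CV [dN N_pi tN].
have [ps [sz fr psz]] := nonsingular_four_zeros char2 qf q_gt2 dpi ns.
have lift (p : mx3 F) : p != 0 -> p \in pi -> f p = 0 ->
    exists x, [/\ C <[ver x]>%VS, ver x \in pi & <[p]>%VS = <[ver x]>%VS].
  move=> p0 p_pi fp.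
  have Cp : C <[p]>%VS.
    apply/Cdef; split; [by rewrite dim_vline p0 | by rewrite -memvE |].
    by move=> _ /vlineP[k ->]; rewrite (proj1 qf) fp mulr0.
  have [x x0 e] := CV _ Cp; exists x; split=> //; first by rewrite /ver -e.
  by rewrite memvE /ver -e -memvE.
have frx (p p' : mx3 F) x x' : free [:: p; p'] -> <[p]>%VS = <[ver x]>%VS ->
    <[p']>%VS = <[ver x']>%VS -> free [:: x; x'].
  rewrite !free_cons !span_seq1 !nil_free !span_nil !memv0 !andbT => /andP[pp' p'0] e e'.
  apply/andP; split.
    apply: contra pp' => /vlineP[k ek].
    by rewrite memvE e' e -memvE ek verZ memvZ ?memv_line.
  rewrite -ver_eq0; have := congr1 (@dimv _ _) e'; rewrite !dim_vline p'0.
  by case: eqP.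
case: ps sz fr psz => [|p1 [|p2 [|p3 [|p4 []]]]] //= _.
rewrite !andbT => /and3P[/and3P[f12 f13 f14] /andP[f23 f24] f34] psz.
have nz (p p' : mx3 F) : free [:: p; p'] -> p != 0 /\ p' != 0.
  by move=> fr; split; apply: (free_not0 fr); rewrite !inE eqxx ?orbT.
have [[n1 n2] [n3 n4]] := (nz _ _ f12, nz _ _ f34).
have /psz[i1 z1] : p1 \in [:: p1; p2; p3; p4] by rewrite !inE eqxx.
have /psz[i2 z2] : p2 \in [:: p1; p2; p3; p4] by rewrite !inE eqxx ?orbT.
have /psz[i3 z3] : p3 \in [:: p1; p2; p3; p4] by rewrite !inE eqxx ?orbT.
have /psz[i4 z4] : p4 \in [:: p1; p2; p3; p4] by rewrite !inE eqxx ?orbT.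
have [x1 [C1 v1 e1]] := lift _ n1 i1 z1; have [x2 [C2 v2 e2]] := lift _ n2 i2 z2.
have [x3 [C3 v3 e3]] := lift _ n3 i3 z3; have [x4 [C4 v4 e4]] := lift _ n4 i4 z4.
have {}f12 := frx _ _ _ _ f12 e1 e2; have {}f13 := frx _ _ _ _ f13 e1 e3.
have {}f23 := frx _ _ _ _ f23 e2 e3; have {}f14 := frx _ _ _ _ f14 e1 e4.
have {}f24 := frx _ _ _ _ f24 e2 e4; have {}f34 := frx _ _ _ _ f34 e3 e4.
have nofree x k : free [:: x; k *: x] -> False.
  move/free2P => /(_ k (-1)); rewrite scaleN1r subrr => /(_ erefl)[_ /eqP].
  by rewrite oppr_eq0 oner_eq0.
(* If x1, x2, x3 were independent, their images would span the plane, and x4 would be proportional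
   to one of them. *)
have [/span2P[a [b e]]|nsp] := boolP (x3 \in <<[:: x1; x2]>>%VS); last first.
  have fr : free [:: x3; x1; x2] by rewrite free_cons nsp.
  have epi : pi = <<[:: ver x3; ver x1; ver x2]>>%VS.
    apply: free_span_dim; last by rewrite dpi.
      exact: free_ver.
    by move=> v; rewrite !inE => /or3P[]/eqP->.
  rewrite epi in v4; exfalso; have [k [] ek] := ver_in_span fr v4.
  - by apply: (nofree x3 k); rewrite -ek.
  - by apply: (nofree x1 k); rewrite -ek.
  - by apply: (nofree x2 k); rewrite -ek.
have a0 : a != 0.
  apply/eqP => a0; apply: (nofree x2 b).
  by move: f23; rewrite e a0 scale0r add0r.
have b0 : b != 0.
  apply/eqP => b0; apply: (nofree x1 a).
  by move: f13; rewrite e b0 scale0r addr0.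
(* [ver x3] is the conic point with parameters a and b; as ab != 0, its last term can be solved
   for. *)
have n12 : nuc x1 x2 \in pi.
  have : conic_point (ver x1) (ver x2) (nuc x1 x2) a b \in pi by rewrite -verD -e.
  by rewrite rpredDl ?rpredZeq ?mulf_eq0 ?(negPf a0) ?(negPf b0) // memvD ?memvZ.
have f21 : free [:: x2; x1].
  by rewrite (perm_free (_ : perm_eq _ [:: x1; x2])) // (perm_catC [:: x2] [:: x1]).
have l1 := tN _ (tangent_line_ver f12 CV C1 v1 n12).
have n21 : nuc x2 x1 = nuc x1 x2 by rewrite /nuc wedgeC.
have := tangent_line_ver f21 CV C2 v2; rewrite n21 => /(_ n12)/tN l2.
exists x1, x2; have [v _ eN] := dim1_vline dN.
by rewrite eN -memvE; apply: (tangents_meet f12); rewrite memvE -eN.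
Qed.

Lemma free_nuc x y z : free [:: x; y; z] ->
  free [:: nuc x y; nuc x z; nuc y z].
Proof.
move=> /free_wedge/free3P fr; apply/free3P => a b c.
rewrite !MZ !MD -M00 => /M_inj[_].
rewrite !scale_in_alg !(mulrCA _ w) -!mulrDr -!scale_in_alg => /eqP.
by rewrite mulf_eq0 (negPf w0) => /eqP/fr.
Qed.

(** * The nuclear plane when F has degree 3 over K *)

Hypothesis dimF : \dim {: F} = 3%N.

(** Three independent wedges form a K-basis of F, so a1 / w is a combination of them. *)
Lemma span_nuc x y z v : free [:: x; y; z] ->
  v \in <<[:: nuc x y; nuc x z; nuc y z]>>%VS <-> exists a1, v = M 0 a1.
Proof.
move=> fr; split=> [/span3P[a [b [c ->]]]|[a1 ->]].
  by rewrite !MZ !MD !scaler0 !addr0; eexists.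
have : a1 / w \in <<[:: wedge x y; wedge x z; wedge y z]>>%VS.
  rewrite -(@free_span_dim _ _ {: F}%VS) ?memvf //; first exact: free_wedge.
  by move=> ? _; rewrite memvf.
case/span3P=> a [b [c e]]; apply/span3P; exists a, b, c.
rewrite !MZ !MD !scaler0 !addr0 -[in LHS](divfK w0 a1) e mulrC.
by rewrite !scale_in_alg !(mulrCA (in_alg F _) w) -!mulrDr.
Qed.

Lemma exists_free3 : exists x y z, free [:: x; y; z].
Proof.
have [x _ n1] : exists2 u : F, u \in {: F}%VS & u \notin <<[::]>>%VS.
  by apply: exists_outside; rewrite dimF.
have [y _ n2] : exists2 u : F, u \in {: F}%VS & u \notin <<[:: x]>>%VS.
  by apply: exists_outside; rewrite dimF.
have [z _ n3] : exists2 u : F, u \in {: F}%VS & u \notin <<[:: y; x]>>%VS.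
  by apply: exists_outside; rewrite dimF.
by exists z, y, x; rewrite !free_cons n1 n2 n3 nil_free.
Qed.

(** The image of the K-line through x and y is a standard conic on the surface with this nucleus. *)
Lemma nuc_in_plane U x y : contains_nuclei (W F) (veronese w) U ->
  free [:: x; y] -> nuc x y \in U.
Proof.
move=> cU fr; have fr3 := free_conic fr.
rewrite memvE; apply: (cU _ _ _ _ (standard_conicP char2 fr3) _
  (standard_conic_nucleus char2 fr3)).
  split; first by rewrite (eqP fr3).
  apply/span_subvP => v; rewrite !inE => /or3P[]/eqP->; exact: M_in_W.
by move=> P /(standard_conic_ver fr).
Qed.

(** [N] is given by its elements M(0, a1), a description free of w, so that one plane can serve
    several surfaces. Uniqueness: a plane containing all nuclei contains three independent ones that
    span [N]. *)
Lemma nuclear_plane_veronese N : (2 < q)%N ->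
  (forall v, v \in N <-> exists a1, v = M 0 a1) ->
  is_nuclear_plane (W F) (veronese w) N.
Proof.
move=> q_gt2 Ndef; have [x [y [z fr]]] := exists_free3.
have eN : N = <<[:: nuc x y; nuc x z; nuc y z]>>%VS.
  apply/vspaceP => v; apply/idP/idP.
    by move/Ndef => ex; apply/span_nuc.
  by move/(span_nuc _ fr) => ex; apply/Ndef.
have dN : \dim N = 3%N by rewrite eN (eqP (free_nuc fr)).
split.
- by split=> //; apply/subvP => v /Ndef[a1 ->]; apply: M_in_W.
- move=> pi C n [dpi _] cC CV nn.
  have [u [v nuv]] := conic_in_veronese_nucleus q_gt2 dpi cC CV nn.
  apply: (subv_trans nuv); rewrite -memvE; apply/Ndef; by exists (w * wedge u v).
move=> pi' [dpi' _] cpi'; apply/esym/eqP; rewrite eqEdim dN dpi' leqnn andbT.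
have [f1 f2 f3] : [/\ free [:: x; y], free [:: x; z] & free [:: y; z]].
  split; apply/free2P => a b e; have /free3P fr' := fr.
  - by have [] := fr' a b 0; rewrite ?e ?scale0r ?addr0.
  - by have [] := fr' a 0 b; rewrite ?e ?scale0r ?addr0.
  by have [] := fr' 0 a b; rewrite ?e ?scale0r ?add0r.
rewrite eN; apply/span_subvP => v; rewrite !inE.
by case/or3P=> /eqP->; apply: nuc_in_plane.
Qed.

End NuclearPlane.

Theorem theorem4p7 (K : finFieldType) (F : fieldExtType K) (alpha : K)
    (q_gt2 : (2 < #|K|)%N) (dimF : \dim {: F} = 3%N)
    (alpha_odd : odd #|K| -> alpha = -1)
    (alpha_even : ~~ odd #|K| -> alpha != 0 /\ alpha != 1) :
  (odd #|K| ->
     forall P : {vspace mx3 F}, ~ (chordal1 P /\ chordal alpha%:A P)) /\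
  (~~ odd #|K| ->
     exists N : {vspace mx3 F},
       [/\ forall v : mx3 F, v \in N <-> exists a1 : F, v = M 0 a1,
           is_nuclear_plane (W F) (@veronese K F 1) N,
           is_nuclear_plane (W F) (veronese alpha%:A) N
         & forall P : {vspace mx3 F},
             chordal1 P -> chordal alpha%:A P -> (P <= N)%VS]).
Proof.
split=> [q_odd P|q_even].
  by rewrite (alpha_odd q_odd); apply: chordal_disjoint_odd.
have [al0 al1] := alpha_even q_even.
have char2 : 2 \in [pchar K] by rewrite char2_card.
have alF0 : alpha%:A != 0 :> F by rewrite scaler_eq0 (negPf al0) oner_eq0.
have [x [y [z fr]]] := exists_free3 dimF.
(* Built from the surface with w = 1; [Ndef] then identifies it as the nuclear plane for w = alpha
   as well. *)
exists <<[:: nuc 1 x y; nuc 1 x z; nuc 1 y z]>>%VS.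
have Ndef v := span_nuc char2 (oner_neq0 F) dimF v fr.
split=> //.
- exact: (@nuclear_plane_veronese K F 1 char2 (oner_neq0 F) dimF _ q_gt2 Ndef).
- exact: (@nuclear_plane_veronese K F alpha%:A char2 alF0 dimF _ q_gt2 Ndef).
move=> P c1 c2; have [a1 ->] := chordal_meet_even char2 al0 al1 c1 c2.
by rewrite -memvE; apply/Ndef; exists a1.
Qed.
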